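(* Let $\mathbf{k}$ be a commutative ring with unit. The categories $\mathbf{XDias}$ of crossed modules of $\mathbf{k}$-dialgebras, $\mathbf{CDias}$ of $\mathrm{cat}^1$-dialgebras over $\mathbf{k}$, and $\mathbf{IDias}$ of internal categories in the category of $\mathbf{k}$-dialgebras are equivalent.
   Context: All algebras are over a fixed commutative ring $\mathbf{k}$ with unit. A dialgebra is a $\mathbf{k}$-module $D$ with two $\mathbf{k}$-bilinear products $\dashv,\vdash$ such that for all $x,y,z$: (1) $(x\dashv y)\dashv z=x\dashv(y\vdash z)$; (2) $(x\dashv y)\dashv z=x\dashv(y\dashv z)$; (3) $(x\vdash y)\dashv z=x\vdash(y\dashv z)$; (4) $(x\dashv y)\vdash z=x\vdash(y\vdash z)$; (5) $(x\vdash y)\vdash z=x\vdash(y\vdash z)$. Morphisms are linear maps preserving both products; the category is $\mathbf{Dias}$. An action of a dialgebra $D$ on a dialgebra $L$ consists of four bilinear maps $\dashv,\vdash\colon D\otimes L\to L$ and $\dashv,\vdash\colon L\otimes D\to L$ satisfying the 30 equalities obtained from (1)–(5) by taking one variable in $D$ and two in $L$ (15 equalities), or one variable in $L$ and two in $D$ (15 equalities). A crossed module of dialgebras is a dialgebra homomorphism $\mu\colon L\to D$ with an action of $D$ on $L$ such that, for $\star\in\{\dashv,\vdash\}$, $x\in D$, $l,l'\in L$: $\mu(x\star l)=x\star\mu(l)$, $\mu(l\star x)=\mu(l)\star x$, $\mu(l)\star l'=l\star l'=l\star\mu(l')$. A morphism $(L\xrightarrow{\mu}D)\to(L'\xrightarrow{\mu'}D')$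 is a pair of dialgebra homomorphisms $\alpha\colon L\to L'$, $\beta\colon D\to D'$ with $\mu'\alpha=\beta\mu$, $\alpha(x\star l)=\beta(x)\star\alpha(l)$, $\alpha(l\star x)=\alpha(l)\star\beta(x)$. The category is $\mathbf{XDias}$. A $\mathrm{cat}^1$-dialgebra $(E,D,s,t)$ is a dialgebra $E$ with a subdialgebra $D$ and two dialgebra homomorphisms $s,t\colon E\to D$ such that $s|_D=t|_D=\mathrm{id}_D$ and $\operatorname{Ker}s\dashv\operatorname{Ker}t=\operatorname{Ker}t\dashv\operatorname{Ker}s=\operatorname{Ker}s\vdash\operatorname{Ker}t=\operatorname{Ker}t\vdash\operatorname{Ker}s=0$. A morphism $(E,D,s,t)\to(E',D',s',t')$ is a dialgebra homomorphism $f\colon E\to E'$ with $f(D)\subseteq D'$, $s'f=f|_Ds$, $t'f=f|_Dt$. The category is $\mathbf{CDias}$. An object $(E,D,s,t,\sigma,\gamma)$ of $\mathbf{IDias}$ is an internal category in $\mathbf{Dias}$: dialgebras $E$ (arrows), $D$ (objects) and dialgebra homomorphisms $s,t\colon E\to D$, $\sigma\colon D\to E$ with $s\sigma=t\sigma=\mathrm{id}_D$, and $\gamma\colon E\times_DE\to E$, where $E\times_DE=\{(e,e')\in E\times E: t(e)=s(e')\}$ with componentwise products, satisfying the usual axioms of a category: $s\gamma(e,e')=s(e)$, $t\gamma(e,e')=t(e')$, $\gamma(\sigma s(e),e)=e=\gamma(e,\sigma t(e))$, and associativity of $\gamma$. Morphisms $(E,D,s,t,\sigma,\gamma)\to(E',D',s',t',\sigma',\gamma')$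 are pairs of dialgebra homomorphisms $\varphi\colon E\to E'$, $\psi\colon D\to D'$ with $\psi s=s'\varphi$, $\psi t=t'\varphi$, $\varphi\sigma=\sigma'\psi$, $\varphi\gamma=\gamma'(\varphi\times\varphi)$. *)

(* Defs.v *)
From HB Require Import structures.
From mathcomp Require Import all_boot all_algebra.
From mathcomp Require Import boolp.

Set Implicit Arguments.
Unset Strict Implicit.
Unset Printing Implicit Defensive.

Import GRing.Theory.
Local Open Scope ring_scope.

Record category := Category {
  obj :> Type;
  hom : obj -> obj -> Type;
  idm : forall a, hom a a;
  compose : forall a b c, hom b c -> hom a b -> hom a c;
  compose_idl : forall a b (f : hom a b), compose (idm b) f = f;
  compose_idr : forall a b (f : hom a b), compose f (idm a) = f;
  composeA : forall a b c d (h : hom c d) (g : hom b c) (f : hom a b),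
    compose h (compose g f) = compose (compose h g) f
}.
Arguments idm {_} _.
Arguments compose {_ _ _ _} _ _.

Record functor (C D : category) := Functor {
  fobj :> C -> D;
  fmap : forall a b, hom a b -> hom (fobj a) (fobj b);
  fmap_id : forall a, fmap (idm a) = idm (fobj a);
  fmap_comp : forall a b c (g : hom b c) (f : hom a b),
    fmap (compose g f) = compose (fmap g) (fmap f)
}.
Arguments fmap {_ _} _ {_ _} _.

Definition functor_id (C : category) : functor C C :=
  @Functor C C id (fun _ _ f => f) (fun _ => erefl) (fun _ _ _ _ _ => erefl).

Definition functor_comp (C D E : category) (G : functor D E) (F : functor C D) :
  functor C E.
Proof.
refine (@Functor C E (fun a => G (F a)) (fun _ _ f => fmap G (fmap F f)) _ _).
- by move=> a; rewrite !fmap_id.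
- by move=> a b c g f; rewrite !fmap_comp.
Defined.

Definition is_iso (C : category) (a b : C) (f : hom a b) : Prop :=
  exists g : hom b a, compose g f = idm a /\ compose f g = idm b.

Definition naturally_isomorphic (C D : category) (F G : functor C D) : Prop :=
  exists eta : forall a, hom (F a) (G a),
    (forall a b (f : hom a b),
      compose (fmap G f) (eta a) = compose (eta b) (fmap F f))
    /\ (forall a, is_iso (eta a)).

Definition equivalent_categories (C D : category) : Prop :=
  exists (F : functor C D) (G : functor D C),
    naturally_isomorphic (functor_comp G F) (functor_id C) /\
    naturally_isomorphic (functor_comp F G) (functor_id D).

(* The two products of a dialgebra: [dashv] is ⊣ and [vdash] is ⊢. *)
Inductive star := dashv | vdash.

(* A pair of bilinear maps X × Y -> Z, indexed by [star]. Bilinearity is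
   spelled out because {bilinear _ -> _ -> _} excludes the zero ring. *)
Record products (k : comPzRingType) (X Y Z : lmodType k) := Products {
  prod_fun :> star -> X -> Y -> Z;
  prod_linear_l : forall s y, linear (fun x => prod_fun s x y);
  prod_linear_r : forall s x, linear (prod_fun s x)
}.

(* The five dialgebra identities, for x : X, y : Y, z : Z in possibly different
   modules: [p12] multiplies x by y, [p12_3] multiplies (x y) by z, [p23]
   multiplies y by z, and [p1_23] multiplies x by (y z). *)
Definition dialgebra_laws (k : comPzRingType) (X Y Z XY YZ W : lmodType k)
    (p12 : products X Y XY) (p12_3 : products XY Z W)
    (p23 : products Y Z YZ) (p1_23 : products X YZ W) : Prop :=
  forall (x : X) (y : Y) (z : Z),
  [/\ p12_3 dashv (p12 dashv x y) z = p1_23 dashv x (p23 vdash y z),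
      p12_3 dashv (p12 dashv x y) z = p1_23 dashv x (p23 dashv y z),
      p12_3 dashv (p12 vdash x y) z = p1_23 vdash x (p23 dashv y z),
      p12_3 vdash (p12 dashv x y) z = p1_23 vdash x (p23 vdash y z)
    & p12_3 vdash (p12 vdash x y) z = p1_23 vdash x (p23 vdash y z)].

Record dialgebra (k : comPzRingType) := Dialgebra {
  dias_sort :> lmodType k;
  dias_mul : products dias_sort dias_sort dias_sort;
  dias_laws : dialgebra_laws dias_mul dias_mul dias_mul dias_mul
}.
Arguments dias_mul {_} _.

Notation "x *_[ s ] y" := (dias_mul _ s x y)
  (at level 40, s at level 99, left associativity, format "x  *_[ s ]  y").

Record dias_hom (k : comPzRingType) (E F : dialgebra k) := DiasHom {
  dias_fun :> {linear E -> F};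
  dias_funM : forall s x y, dias_fun (x *_[s] y) = dias_fun x *_[s] dias_fun y
}.

Section DiasCategory.
Variable k : comPzRingType.

Lemma dias_hom_eq (E F : dialgebra k) (f g : dias_hom E F) : f =1 g -> f = g.
Proof.
case: f => f fM; case: g => g gM /= fg.
suff e : f = g.
  by case: g / e gM fg => gM _; congr DiasHom; apply: Prop_irrelevance.
case: f g {fM gM} fg => [f [[f1] [f2]]] [g [[g1] [g2]]] /= /funext fg.
case: g / fg g1 g2 => g1 g2.
by rewrite (Prop_irrelevance f1 g1) (Prop_irrelevance f2 g2).
Qed.

Definition dias_id (E : dialgebra k) : dias_hom E E :=
  @DiasHom k E E idfun (fun _ _ _ => erefl).

Lemma dias_comp_subproof (E F G : dialgebra k) (g : dias_hom F G)
    (f : dias_hom E F) s x y :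
  (g \o f) (x *_[s] y) = (g \o f) x *_[s] (g \o f) y.
Proof. by rewrite /= !dias_funM. Qed.

Definition dias_comp (E F G : dialgebra k) (g : dias_hom F G)
  (f : dias_hom E F) : dias_hom E G :=
  @DiasHom k E G (g \o f) (dias_comp_subproof g f).

End DiasCategory.

Record subdialgebra (k : comPzRingType) (E : dialgebra k) := Subdialgebra {
  subd_pred :> {pred E};
  subd_submod : submod_closed subd_pred;
  subd_mul : forall s, {in subd_pred &, forall x y, x *_[s] y \in subd_pred}
}.

Section SubDialgebra.
Variables (k : comPzRingType) (E : dialgebra k) (S : subdialgebra E).

Record subd_sort := SubdSort { subd_val : E; _ : subd_val \in subd_pred S }.

HB.instance Definition _ := [isSub for subd_val].
HB.instance Definition _ := [Choice of subd_sort by <:].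
HB.instance Definition _ :=
  GRing.SubChoice_isSubLmodule.Build k E (subd_pred S) subd_sort (subd_submod S).

Definition subd_op (s : star) (x y : subd_sort) : subd_sort :=
  SubdSort (subd_mul s (valP x) (valP y)).

Lemma subd_op_linear_l s y : linear (fun x => subd_op s x y).
Proof.
by move=> a x x'; apply: val_inj; rewrite /= prod_linear_l.
Qed.

Lemma subd_op_linear_r s x : linear (subd_op s x).
Proof.
by move=> a y y'; apply: val_inj; rewrite /= prod_linear_r.
Qed.

Definition subd_products := Products subd_op_linear_l subd_op_linear_r.

Lemma subd_laws :
  dialgebra_laws subd_products subd_products subd_products subd_products.
Proof.
by move=> x y z; have [*] := dias_laws (val x) (val y) (val z);
  split; apply: val_inj.
Qed.

Definition subd_dialgebra : dialgebra k := Dialgebra subd_laws.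

End SubDialgebra.
Coercion subd_dialgebra : subdialgebra >-> dialgebra.

Section ProdDialgebra.
Variables (k : comPzRingType) (E F : dialgebra k).

Definition prodd_op (s : star) (x y : E * F) : E * F :=
  (x.1 *_[s] y.1, x.2 *_[s] y.2).

Lemma prodd_op_linear_l s y : linear (fun x => prodd_op s x y).
Proof. by move=> a x x'; rewrite /prodd_op /= !prod_linear_l. Qed.

Lemma prodd_op_linear_r s x : linear (prodd_op s x).
Proof. by move=> a x' y'; rewrite /prodd_op /= !prod_linear_r. Qed.

Definition prodd_products := Products prodd_op_linear_l prodd_op_linear_r.

Lemma prodd_laws :
  dialgebra_laws prodd_products prodd_products prodd_products prodd_products.
Proof.
move=> x y z; rewrite /= /prodd_op /=.
have [? ? ? ? ?] := dias_laws x.1 y.1 z.1.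
by have [? ? ? ? ?] := dias_laws x.2 y.2 z.2; split; congr pair.
Qed.

Definition prod_dialgebra : dialgebra k := Dialgebra prodd_laws.

End ProdDialgebra.

(* An action of D on L. Each of the six families of five identities is named
   after the modules containing x, y and z, in this order. *)
Record dias_action (k : comPzRingType) (D L : dialgebra k) := DiasAction {
  actl : products D L L;
  actr : products L D L;
  act_DLL : dialgebra_laws actl (dias_mul L) (dias_mul L) actl;
  act_LDL : dialgebra_laws actr (dias_mul L) actl (dias_mul L);
  act_LLD : dialgebra_laws (dias_mul L) actr actr (dias_mul L);
  act_LDD : dialgebra_laws actr actr (dias_mul D) actr;
  act_DLD : dialgebra_laws actl actr actr actl;
  act_DDL : dialgebra_laws (dias_mul D) actl actl actl
}.

Record crossed_module (k : comPzRingType) := CrossedModule {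
  xm_L : dialgebra k;
  xm_D : dialgebra k;
  xm_mu : dias_hom xm_L xm_D;
  xm_act : dias_action xm_D xm_L;
  xm_mul : forall s x l, xm_mu (actl xm_act s x l) = x *_[s] xm_mu l;
  xm_mur : forall s l x, xm_mu (actr xm_act s l x) = xm_mu l *_[s] x;
  xm_peifferl : forall s l l', actl xm_act s (xm_mu l) l' = l *_[s] l';
  xm_peifferr : forall s l l', actr xm_act s l (xm_mu l') = l *_[s] l'
}.

Record xm_hom (k : comPzRingType) (M N : crossed_module k) := XmHom {
  xm_alpha : dias_hom (xm_L M) (xm_L N);
  xm_beta : dias_hom (xm_D M) (xm_D N);
  xm_hom_mu : forall l, xm_mu N (xm_alpha l) = xm_beta (xm_mu M l);
  xm_hom_actl : forall s x l, xm_alpha (actl (xm_act M) s x l) =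
    actl (xm_act N) s (xm_beta x) (xm_alpha l);
  xm_hom_actr : forall s l x, xm_alpha (actr (xm_act M) s l x) =
    actr (xm_act N) s (xm_alpha l) (xm_beta x)
}.

Section XDias.
Variable k : comPzRingType.

Lemma xm_hom_eq (M N : crossed_module k) (f g : xm_hom M N) :
  xm_alpha f = xm_alpha g -> xm_beta f = xm_beta g -> f = g.
Proof.
case: f => a b f1 f2 f3; case: g => a' b' g1 g2 g3 /= ea eb.
move: f1 f2 f3; rewrite ea eb => f1 f2 f3.
by congr XmHom; apply: Prop_irrelevance.
Qed.

Definition xm_id (M : crossed_module k) : xm_hom M M :=
  @XmHom k M M (dias_id _) (dias_id _)
    (fun _ => erefl) (fun _ _ _ => erefl) (fun _ _ _ => erefl).

Definition xm_comp (M N P : crossed_module k) (g : xm_hom N P)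
  (f : xm_hom M N) : xm_hom M P.
Proof.
refine (@XmHom k M P (dias_comp (xm_alpha g) (xm_alpha f))
  (dias_comp (xm_beta g) (xm_beta f)) _ _ _).
- by move=> l /=; rewrite !xm_hom_mu.
- by move=> s x l /=; rewrite !xm_hom_actl.
- by move=> s l x /=; rewrite !xm_hom_actr.
Defined.

Definition XDias : category.
Proof.
refine (@Category (crossed_module k) (@xm_hom k) xm_id xm_comp _ _ _);
  by move=> *; apply: xm_hom_eq; apply: dias_hom_eq.
Defined.

End XDias.

Record cat1_dialgebra (k : comPzRingType) := Cat1Dialgebra {
  c1_E : dialgebra k;
  c1_D : subdialgebra c1_E;
  c1_s : dias_hom c1_E c1_D;
  c1_t : dias_hom c1_E c1_D;
  c1_s_id : forall d : c1_D, c1_s (val d) = d;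
  c1_t_id : forall d : c1_D, c1_t (val d) = d;
  c1_ker_st : forall st x y, c1_s x = 0 -> c1_t y = 0 -> x *_[st] y = 0;
  c1_ker_ts : forall st x y, c1_t x = 0 -> c1_s y = 0 -> x *_[st] y = 0
}.

(* Both sides of [s' f = f|_D s] are compared in E'. *)
Record c1_hom (k : comPzRingType) (A B : cat1_dialgebra k) := C1Hom {
  c1_f :> dias_hom (c1_E A) (c1_E B);
  c1_f_sub : forall x, x \in subd_pred (c1_D A) -> c1_f x \in subd_pred (c1_D B);
  c1_f_s : forall e, val (c1_s B (c1_f e)) = c1_f (val (c1_s A e));
  c1_f_t : forall e, val (c1_t B (c1_f e)) = c1_f (val (c1_t A e))
}.

Section CDias.
Variable k : comPzRingType.

Lemma c1_hom_eq (A B : cat1_dialgebra k) (f g : c1_hom A B) :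
  c1_f f = c1_f g -> f = g.
Proof.
case: f => f f1 f2 f3; case: g => g g1 g2 g3 /= e.
move: f1 f2 f3; rewrite e => f1 f2 f3.
by congr C1Hom; apply: Prop_irrelevance.
Qed.

Definition c1_id (A : cat1_dialgebra k) : c1_hom A A :=
  @C1Hom k A A (dias_id _) (fun _ h => h) (fun _ => erefl) (fun _ => erefl).

Definition c1_comp (A B C : cat1_dialgebra k) (g : c1_hom B C)
  (f : c1_hom A B) : c1_hom A C.
Proof.
refine (@C1Hom k A C (dias_comp g f) _ _ _).
- by move=> x xD; do 2 apply: c1_f_sub.
- by move=> e /=; rewrite !c1_f_s.
- by move=> e /=; rewrite !c1_f_t.
Defined.

Definition CDias : category.
Proof.
refine (@Category (cat1_dialgebra k) (@c1_hom k) c1_id c1_comp _ _ _);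
  by move=> *; apply: c1_hom_eq; apply: dias_hom_eq.
Defined.

End CDias.

Section Composable.
Variables (k : comPzRingType) (E D : dialgebra k) (s t : dias_hom E D).

Definition composable_pred : {pred prod_dialgebra E E} :=
  fun p => t p.1 == s p.2.

Lemma composable_submod : submod_closed composable_pred.
Proof.
split=> [|a p q]; first by rewrite unfold_in !linear0.
by rewrite !unfold_in /= !linearP => /eqP -> /eqP ->.
Qed.

Lemma composable_mul st :
  {in composable_pred &, forall p q, p *_[st] q \in composable_pred}.
Proof.
by move=> p q; rewrite !unfold_in /= !dias_funM => /eqP -> /eqP ->.
Qed.

(* The pullback E ×_D E of pairs (e, e') with t e = s e', as a subdialgebra of
   E × E. *)
Definition composable : subdialgebra (prod_dialgebra E E) :=
  Subdialgebra composable_submod composable_mul.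

Lemma composable_pair_subproof (e e' : E) :
  t e = s e' -> (e, e') \in composable_pred.
Proof. by move=> h; rewrite unfold_in /= h. Qed.

Definition composable_pair (e e' : E) (h : t e = s e') : composable :=
  @SubdSort k _ composable (e, e') (composable_pair_subproof h).

End Composable.

Record internal_category (k : comPzRingType) := InternalCategory {
  ic_E : dialgebra k;
  ic_D : dialgebra k;
  ic_s : dias_hom ic_E ic_D;
  ic_t : dias_hom ic_E ic_D;
  ic_sigma : dias_hom ic_D ic_E;
  ic_gamma : dias_hom (composable ic_s ic_t) ic_E;
  ic_s_sigma : forall d, ic_s (ic_sigma d) = d;
  ic_t_sigma : forall d, ic_t (ic_sigma d) = d;
  ic_s_gamma : forall e e' (h : ic_t e = ic_s e'),
    ic_s (ic_gamma (composable_pair h)) = ic_s e;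
  ic_t_gamma : forall e e' (h : ic_t e = ic_s e'),
    ic_t (ic_gamma (composable_pair h)) = ic_t e';
  ic_unitl : forall e,
    ic_gamma (@composable_pair k _ _ ic_s ic_t (ic_sigma (ic_s e)) e
      (ic_t_sigma (ic_s e))) = e;
  ic_unitr : forall e,
    ic_gamma (@composable_pair k _ _ ic_s ic_t e (ic_sigma (ic_t e))
      (esym (ic_s_sigma (ic_t e)))) = e;
  ic_assoc : forall e1 e2 e3 (h12 : ic_t e1 = ic_s e2) (h23 : ic_t e2 = ic_s e3),
    ic_gamma (@composable_pair k _ _ ic_s ic_t
      (ic_gamma (composable_pair h12)) e3 (etrans (ic_t_gamma h12) h23)) =
    ic_gamma (@composable_pair k _ _ ic_s ic_t
      e1 (ic_gamma (composable_pair h23)) (etrans h12 (esym (ic_s_gamma h23))))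
}.

Lemma composable_map (T T' U U' : Type) (s t : T -> U) (s' t' : T' -> U')
    (f : T -> T') (g : U -> U')
    (fs : forall e, g (s e) = s' (f e)) (ft : forall e, g (t e) = t' (f e)) e e' :
  t e = s e' -> t' (f e) = s' (f e').
Proof. by move=> h; rewrite -fs -ft h. Qed.

Record ic_hom (k : comPzRingType) (A B : internal_category k) := IcHom {
  ic_phi : dias_hom (ic_E A) (ic_E B);
  ic_psi : dias_hom (ic_D A) (ic_D B);
  ic_hom_s : forall e, ic_psi (ic_s A e) = ic_s B (ic_phi e);
  ic_hom_t : forall e, ic_psi (ic_t A e) = ic_t B (ic_phi e);
  ic_hom_sigma : forall d, ic_phi (ic_sigma A d) = ic_sigma B (ic_psi d);
  ic_hom_gamma : forall e e' (h : ic_t A e = ic_s A e'),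
    ic_phi (ic_gamma A (composable_pair h)) =
    ic_gamma B (@composable_pair k _ _ (ic_s B) (ic_t B) (ic_phi e) (ic_phi e')
      (composable_map ic_hom_s ic_hom_t h))
}.

Section IDias.
Variable k : comPzRingType.

Lemma ic_hom_eq (A B : internal_category k) (f g : ic_hom A B) :
  ic_phi f = ic_phi g -> ic_psi f = ic_psi g -> f = g.
Proof.
case: f => a b f1 f2 f3 f4; case: g => a' b' g1 g2 g3 g4 /= ea eb.
case: a' / ea g1 g2 g3 g4 => g1; case: b' / eb g1 => g1 g2 g3.
rewrite (Prop_irrelevance f1 g1) in f4 *.
rewrite (Prop_irrelevance f2 g2) in f4 * => g4.
by congr IcHom; apply: Prop_irrelevance.
Qed.

Definition ic_id (A : internal_category k) : ic_hom A A.
Proof.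
refine (@IcHom k A A (dias_id _) (dias_id _)
  (fun _ => erefl) (fun _ => erefl) (fun _ => erefl) _).
by move=> e e' h /=; congr (ic_gamma A _); apply: val_inj.
Defined.

Section Comp.
Variables (A B C : internal_category k) (g : ic_hom B C) (f : ic_hom A B).
Let phi := dias_comp (ic_phi g) (ic_phi f).
Let psi := dias_comp (ic_psi g) (ic_psi f).

Lemma ic_comp_s e : psi (ic_s A e) = ic_s C (phi e).
Proof. by rewrite /= !ic_hom_s. Qed.

Lemma ic_comp_t e : psi (ic_t A e) = ic_t C (phi e).
Proof. by rewrite /= !ic_hom_t. Qed.

Lemma ic_comp_sigma d : phi (ic_sigma A d) = ic_sigma C (psi d).
Proof. by rewrite /= !ic_hom_sigma. Qed.

Lemma ic_comp_gamma e e' (h : ic_t A e = ic_s A e') :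
  phi (ic_gamma A (composable_pair h)) =
  ic_gamma C (composable_pair (composable_map ic_comp_s ic_comp_t h)).
Proof.
by rewrite /= !ic_hom_gamma; congr (ic_gamma C _); apply: val_inj.
Qed.

Definition ic_comp : ic_hom A C :=
  IcHom ic_comp_sigma ic_comp_gamma.

End Comp.

Definition IDias : category.
Proof.
refine (@Category (internal_category k) (@ic_hom k) ic_id ic_comp _ _ _);
  by move=> *; apply: ic_hom_eq; apply: dias_hom_eq.
Defined.

End IDias.

(* Main.v *)
Require Import Defs.
From mathcomp Require Import all_boot all_algebra.
From HB Require Import structures.
From mathcomp Require Import boolp.

(* Two functors are fully faithful and essentially surjective, and the third
   equivalence is their composite. A crossed module mu : L -> D goes to the
   semidirect product of L by D, with s (l, x) = x and t (l, x) = mu l + x;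
   a cat^1-dialgebra is recovered from Ker s, on which D acts by multiplication
   in E, because e = (e - s e) + s e. A cat^1-dialgebra becomes an internal
   category through gamma (e, e') = e + e' - t e, which is multiplicative
   precisely because Ker s and Ker t annihilate each other; conversely the unit
   laws and the additivity of gamma force this formula. *)

Set Implicit Arguments.
Unset Strict Implicit.
Unset Printing Implicit Defensive.

Import Defs GRing.Theory.
Local Open Scope ring_scope.

(** * Fully faithful, essentially surjective functors are equivalences *)

Section FullyFaithful.

Definition full (C D : category) (F : functor C D) : Prop :=
  forall (a b : C) (g : hom (F a) (F b)), exists f, fmap F f = g.

Definition faithful (C D : category) (F : functor C D) : Prop :=
  forall (a b : C) (f g : hom a b), fmap F f = fmap F g -> f = g.

Definition essentially_surjective (C D : category) (F : functor C D) : Prop :=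
  forall d : D, exists (c : C) (f : hom (F c) d), is_iso f.

Definition weak_equivalence (C D : category) (F : functor C D) : Prop :=
  [/\ full F, faithful F & essentially_surjective F].

Lemma is_iso_comp (C : category) (a b c : C) (g : hom b c) (f : hom a b) :
  is_iso g -> is_iso f -> is_iso (compose g f).
Proof.
move=> [g' [g'g gg']] [f' [f'f ff']]; exists (compose f' g'); split.
- by rewrite composeA -(composeA f') g'g compose_idr.
- by rewrite composeA -(composeA g) ff' compose_idr.
Qed.

Lemma is_iso_fmap (C D : category) (F : functor C D) (a b : C) (f : hom a b) :
  is_iso f -> is_iso (fmap F f).
Proof.
by move=> [g [gf fg]]; exists (fmap F g); rewrite -!fmap_comp gf fg !fmap_id.
Qed.

Lemma weak_equivalence_comp (C D E : category) (G : functor D E)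
    (F : functor C D) :
  weak_equivalence G -> weak_equivalence F ->
  weak_equivalence (functor_comp G F).
Proof.
move=> [Gfull Gfaith Gsurj] [Ffull Ffaith Fsurj]; split.
- move=> a b g; have [h <-] := Gfull _ _ g; have [f <-] := Ffull _ _ h.
  by exists f.
- by move=> a b f g /Gfaith /Ffaith.
- move=> e; have [d [g g_iso]] := Gsurj e; have [c [f f_iso]] := Fsurj d.
  exists c, (compose g (fmap G f)); apply: is_iso_comp => //.
  exact: is_iso_fmap.
Qed.

Section QuasiInverse.
Variables (C D : category) (F : functor C D).
Hypotheses (Ffull : full F) (Ffaith : faithful F).
Variables (G : D -> C) (e : forall d, hom (F (G d)) d).
Variable e' : forall d, hom d (F (G d)).
Hypotheses (eK : forall d, compose (e' d) (e d) = idm _).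
Hypotheses (e'K : forall d, compose (e d) (e' d) = idm _).

(** Fullness is a bare existence statement, so a preimage is picked by choice; faithfulness makes it
    unique. *)
Definition preimage_hom (a b : C) (g : hom (F a) (F b)) : hom a b :=
  sval (cid (Ffull g)).

Lemma preimage_homK (a b : C) (g : hom (F a) (F b)) :
  fmap F (preimage_hom g) = g.
Proof. exact: svalP (cid (Ffull g)). Qed.

(** An arrow of [D] is conjugated by the isomorphisms [e] and then lifted along [F]. The functor
    laws are checked after applying [F], where the inner [e] and [e'] cancel. *)
Definition quasi_inverse : functor D C.
Proof.
refine (@Functor D C G
  (fun a b f => preimage_hom (compose (e' b) (compose f (e a)))) _ _).
- by move=> a; apply: Ffaith; rewrite preimage_homK compose_idl eK fmap_id.
- move=> a b c g f; apply: Ffaith; rewrite fmap_comp !preimage_homK.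
  by rewrite !composeA -(composeA _ (e b)) e'K compose_idr.
Defined.

Lemma quasi_inverse_equivalence : equivalent_categories C D.
Proof.
exists F, quasi_inverse; split.
(* The component at [a] lifts [e (F a)], an arrow from [F (G (F a))] to [F a]. *)
- exists (fun a => preimage_hom (e (F a))); split.
  + move=> a b f; apply: Ffaith.
    by rewrite !fmap_comp !preimage_homK !composeA e'K compose_idl.
  + move=> a; exists (preimage_hom (e' (F a))).
    by split; apply: Ffaith; rewrite fmap_comp !preimage_homK fmap_id ?eK ?e'K.
- exists e; split=> [a b f|d].
    by rewrite /= preimage_homK !composeA e'K compose_idl.
  by exists (e' d); split; [exact: eK | exact: e'K].
Qed.

End QuasiInverse.

Lemma weak_equivalence_equivalent (C D : category) (F : functor C D) :
  weak_equivalence F -> equivalent_categories C D.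
Proof.
move=> [Ffull Ffaith Fsurj].
(* Object, isomorphism and inverse sit under nested existentials, so choice extracts them one after
   the other. *)
pose G d := sval (cid (Fsurj d)).
have G_iso d : exists f : hom (F (G d)) d, is_iso f := svalP (cid (Fsurj d)).
pose e d := sval (cid (G_iso d)).
have e_iso d : is_iso (e d) := svalP (cid (G_iso d)).
pose e' d := sval (cid (e_iso d)).
have eP d : compose (e' d) (e d) = idm _ /\ compose (e d) (e' d) = idm _ :=
  svalP (cid (e_iso d)).
by apply: (quasi_inverse_equivalence Ffull Ffaith (e := e) (e' := e')) => d;
  have [] := eP d.
Qed.

End FullyFaithful.

(** * Elementary rules for bilinear products, homomorphisms and subdialgebras *)

Section Products.
Variables (k : comPzRingType) (X Y Z : lmodType k) (p : products X Y Z).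
Variable s : star.

Lemma productsDl x x' y : p s (x + x') y = p s x y + p s x' y.
Proof. by have := prod_linear_l p s y 1 x x'; rewrite !scale1r. Qed.

Lemma productsDr x y y' : p s x (y + y') = p s x y + p s x y'.
Proof. by have := prod_linear_r p s x 1 y y'; rewrite !scale1r. Qed.

Lemma products0l y : p s 0 y = 0.
Proof. by apply: (addrI (p s 0 y)); rewrite -productsDl !addr0. Qed.

Lemma products0r x : p s x 0 = 0.
Proof. by apply: (addrI (p s x 0)); rewrite -productsDr !addr0. Qed.

Lemma productsZl a x y : p s (a *: x) y = a *: p s x y.
Proof. by have := prod_linear_l p s y a x 0;
  rewrite !addr0 products0l addr0. Qed.

Lemma productsZr a x y : p s x (a *: y) = a *: p s x y.
Proof. by have := prod_linear_r p s x a y 0;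
  rewrite !addr0 products0r addr0. Qed.

Lemma productsNl x y : p s (- x) y = - p s x y.
Proof. by rewrite -scaleN1r productsZl scaleN1r. Qed.

Lemma productsNr x y : p s x (- y) = - p s x y.
Proof. by rewrite -scaleN1r productsZr scaleN1r. Qed.

Lemma productsBl x x' y : p s (x - x') y = p s x y - p s x' y.
Proof. by rewrite productsDl productsNl. Qed.

Lemma productsBr x y y' : p s x (y - y') = p s x y - p s x y'.
Proof. by rewrite productsDr productsNr. Qed.

End Products.

Section DiasHom.
Variables (k : comPzRingType) (E F : dialgebra k).

Definition dias_hom_of (f : E -> F) (f_lin : linear f)
    (fM : forall s x y, f (x *_[s] y) = f x *_[s] f y) : dias_hom E F :=
  @DiasHom k E F
    (HB.pack_for {linear E -> F} f (GRing.isLinear.Build k E F *:%R f f_lin))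
    fM.

Lemma dias_homD (f : dias_hom E F) x y : f (x + y) = f x + f y.
Proof. exact: linearD. Qed.

Lemma dias_homB (f : dias_hom E F) x y : f (x - y) = f x - f y.
Proof. exact: linearB. Qed.

Lemma dias_homP (f : dias_hom E F) a x y : f (a *: x + y) = a *: f x + f y.
Proof. exact: linearP. Qed.

Lemma dias_hom0 (f : dias_hom E F) : f 0 = 0.
Proof. exact: linear0. Qed.

End DiasHom.

Section Inverse.
Variables (k : comPzRingType) (E F : dialgebra k).
Variables (f : dias_hom E F) (g : F -> E).
Hypotheses (fK : cancel f g) (gK : cancel g f).

Lemma dias_inv_linear : linear g.
Proof. by move=> a x y; apply: (can_inj fK); rewrite dias_homP !gK. Qed.

Lemma dias_invM s x y : g (x *_[s] y) = g x *_[s] g y.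
Proof. by apply: (can_inj fK); rewrite dias_funM !gK. Qed.

Definition dias_inv : dias_hom F E := dias_hom_of dias_inv_linear dias_invM.

End Inverse.

Section SubdVal.
Variables (k : comPzRingType) (E : dialgebra k) (S : subdialgebra E).

Lemma subd_inj (x y : S) : val x = val y -> x = y.
Proof. exact: val_inj. Qed.

Lemma subd_valP (a : k) (x y : S) : val (a *: x + y) = a *: val x + val y.
Proof. by []. Qed.

Definition subd_incl : dias_hom S E :=
  @dias_hom_of k S E val subd_valP (fun _ _ _ => erefl).

End SubdVal.

Section Corestriction.
Variables (k : comPzRingType) (E F : dialgebra k) (S : subdialgebra F).
Variables (f : dias_hom E F) (fS : forall x, f x \in subd_pred S).

Definition corestrict_fun (x : E) : S := @SubdSort k F S (f x) (fS x).

Lemma corestrict_linear : linear corestrict_fun.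
Proof. by move=> a x y; apply: val_inj; rewrite /= dias_homP. Qed.

Lemma corestrictM s x y :
  corestrict_fun (x *_[s] y) = corestrict_fun x *_[s] corestrict_fun y.
Proof. by apply: val_inj; rewrite /= dias_funM. Qed.

Definition dias_corestrict : dias_hom E S :=
  dias_hom_of corestrict_linear corestrictM.

End Corestriction.

(** * The semidirect product of dialgebras *)

Section SemidirectProduct.
Variables (k : comPzRingType) (D L : dialgebra k) (act : dias_action D L).

Definition sdprod_op (s : star) (x y : L * D) : L * D :=
  (x.1 *_[s] y.1 + actl act s x.2 y.1 + actr act s x.1 y.2, x.2 *_[s] y.2).

Lemma sdprod_op_linear_l s y : linear (fun x => sdprod_op s x y).
Proof.
move=> a x x'; rewrite /sdprod_op /= !prod_linear_l; congr pair => /=.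
by rewrite !scalerDr (AC (2*2*2) ((1*3*5)*(2*4*6))).
Qed.

Lemma sdprod_op_linear_r s x : linear (sdprod_op s x).
Proof.
move=> a y y'; rewrite /sdprod_op /= !prod_linear_r; congr pair => /=.
by rewrite !scalerDr (AC (2*2*2) ((1*3*5)*(2*4*6))).
Qed.

Definition sdprod_products := Products sdprod_op_linear_l sdprod_op_linear_r.

(* Expanding both sides of an identity by trilinearity gives one term for each
   choice of a component of x, y and z: DDD, LLL and the six families of the
   action. *)
Lemma sdprod_laws : dialgebra_laws
  sdprod_products sdprod_products sdprod_products sdprod_products.
Proof.
move=> [l a] [m b] [n c]; rewrite /= /sdprod_op /=.
have [e1 e2 e3 e4 e5] := dias_laws l m n.
have [f1 f2 f3 f4 f5] := act_DLL act a m n.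
have [g1 g2 g3 g4 g5] := act_LDL act l b n.
have [h1 h2 h3 h4 h5] := act_LLD act l m c.
have [i1 i2 i3 i4 i5] := act_LDD act l b c.
have [j1 j2 j3 j4 j5] := act_DLD act a m c.
have [u1 u2 u3 u4 u5] := act_DDL act a b n.
have [v1 v2 v3 v4 v5] := dias_laws a b c.
split; congr pair => //=; rewrite !(productsDl, productsDr).
- by rewrite e1 f1 g1 h1 i1 j1 u1 (AC (3*1*3) ((1*3*5)*(2*4*6)*7)).
- by rewrite e2 f2 g2 h2 i2 j2 u2 (AC (3*1*3) ((1*3*5)*(2*4*6)*7)).
- by rewrite e3 f3 g3 h3 i3 j3 u3 (AC (3*1*3) ((1*3*5)*(2*4*6)*7)).
- by rewrite e4 f4 g4 h4 i4 j4 u4 (AC (3*1*3) ((1*3*5)*(2*4*6)*7)).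
- by rewrite e5 f5 g5 h5 i5 j5 u5 (AC (3*1*3) ((1*3*5)*(2*4*6)*7)).
Qed.

Definition sdprod_dialgebra : dialgebra k := Dialgebra sdprod_laws.

Lemma sdprod_inl_linear : linear (fun l : L => (l, 0) : sdprod_dialgebra).
Proof. by move=> a l l'; congr pair; rewrite /= ?scaler0 ?addr0. Qed.

Lemma sdprod_inlM s (l l' : L) :
  (l *_[s] l', 0) = ((l, 0) : sdprod_dialgebra) *_[s] (l', 0).
Proof. by congr pair; rewrite /= !(products0l, products0r) ?addr0. Qed.

Definition sdprod_inl : dias_hom L sdprod_dialgebra :=
  dias_hom_of sdprod_inl_linear sdprod_inlM.

Lemma sdprod_inr_linear : linear (fun x : D => (0, x) : sdprod_dialgebra).
Proof. by move=> a x x'; congr pair; rewrite /= ?scaler0 ?addr0. Qed.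

Lemma sdprod_inrM s (x x' : D) :
  (0, x *_[s] x') = ((0, x) : sdprod_dialgebra) *_[s] (0, x').
Proof. by congr pair; rewrite /= !(products0l, products0r) ?addr0. Qed.

Definition sdprod_inr : dias_hom D sdprod_dialgebra :=
  dias_hom_of sdprod_inr_linear sdprod_inrM.

Lemma sdprod_snd_linear : linear (fun p : sdprod_dialgebra => p.2).
Proof. by []. Qed.

Definition sdprod_snd : dias_hom sdprod_dialgebra D :=
  dias_hom_of sdprod_snd_linear (fun _ _ _ => erefl).

Lemma sdprod_split (p : sdprod_dialgebra) :
  p = sdprod_inl p.1 + sdprod_inr p.2.
Proof. by case: p => l x; congr pair; rewrite /= ?addr0 ?add0r. Qed.

(** Inside the semidirect product the action becomes multiplication; this is how equivariance is
    later read off a homomorphism of cat^1-dialgebras. *)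
Lemma sdprod_actl s x l :
  sdprod_inl (actl act s x l) = sdprod_inr x *_[s] sdprod_inl l.
Proof. by congr pair; rewrite /= !(products0l, products0r) ?addr0 ?add0r. Qed.

Lemma sdprod_actr s l x :
  sdprod_inl (actr act s l x) = sdprod_inl l *_[s] sdprod_inr x.
Proof. by congr pair; rewrite /= !(products0l, products0r) ?addr0 ?add0r. Qed.

End SemidirectProduct.

(** * From crossed modules to cat^1-dialgebras *)

Section Cat1OfCrossedModule.
Variables (k : comPzRingType) (M : crossed_module k).
Let L := xm_L M.
Let D := xm_D M.
Let mu := xm_mu M.
Let act := xm_act M.
Let E := sdprod_dialgebra act.

(** A cat^1-dialgebra has its base inside [E], so [D] is replaced by its copy 0 × D. *)
Definition sdbase_pred : {pred E} := fun p => p.1 == 0.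

Lemma sdbase_submod : submod_closed sdbase_pred.
Proof.
split=> [|a p q]; rewrite !unfold_in //= => /eqP p0 /eqP q0.
by rewrite p0 q0 scaler0 addr0.
Qed.

Lemma sdbase_mul s :
  {in sdbase_pred &, forall p q, (p : E) *_[s] q \in sdbase_pred}.
Proof.
move=> p q; rewrite !unfold_in => /eqP p0 /eqP q0 /=.
by rewrite p0 q0 !(products0l, products0r) !addr0.
Qed.

Definition sdbase : subdialgebra E := Subdialgebra sdbase_submod sdbase_mul.

Lemma sdprod_inr_sdbase x : sdprod_inr act x \in subd_pred sdbase.
Proof. by rewrite unfold_in /=. Qed.

Definition sdbase_inr : dias_hom D sdbase := dias_corestrict sdprod_inr_sdbase.

Lemma sdtarget_linear : linear (fun p : E => mu p.1 + p.2).
Proof.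
move=> a p q; rewrite /= dias_homP scalerDr.
by rewrite (AC (2*2) ((1*3)*(2*4))).
Qed.

(** Equivariance of [mu] turns the two action terms on the left into the two mixed products in the
    expansion of the right side. *)
Lemma sdtargetM s (p q : E) :
  mu (p *_[s] q).1 + (p *_[s] q).2 = (mu p.1 + p.2) *_[s] (mu q.1 + q.2).
Proof.
rewrite /= !dias_homD dias_funM xm_mul xm_mur !(productsDl, productsDr).
by rewrite (AC (3*1) (((1*3)*(2*4)))).
Qed.

Definition sdtarget : dias_hom E D := dias_hom_of sdtarget_linear sdtargetM.

Definition xm_s : dias_hom E sdbase := dias_comp sdbase_inr (sdprod_snd act).
Definition xm_t : dias_hom E sdbase := dias_comp sdbase_inr sdtarget.

Lemma xm_s_id (d : sdbase) : xm_s (val d) = d.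
Proof.
by apply: val_inj; case: d => [[l x] /= ]; rewrite unfold_in => /eqP /= ->.
Qed.

Lemma xm_t_id (d : sdbase) : xm_t (val d) = d.
Proof.
apply: val_inj; case: d => [[l x] /= ]; rewrite unfold_in => /eqP /= ->.
by rewrite dias_hom0 add0r.
Qed.

Lemma xm_ker_s (p : E) : xm_s p = 0 -> p.2 = 0.
Proof. by move=> /(congr1 val) /(congr1 snd). Qed.

Lemma xm_ker_t (p : E) : xm_t p = 0 -> p.2 = - mu p.1.
Proof.
by move=> /(congr1 val) /(congr1 snd) /= /eqP; rewrite addrC addr_eq0 => /eqP.
Qed.

(** The factors have the form [(l, 0)] and [(m, - mu m)], so the first component of the product is l
    m minus the action of [mu m] on l: it vanishes by a Peiffer identity. The opposite order uses
    the other one. *)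
Lemma xm_ker_st s x y : xm_s x = 0 -> xm_t y = 0 -> x *_[s] y = 0.
Proof.
move=> /xm_ker_s x0 /xm_ker_t y0; congr pair => /=; rewrite x0 y0.
  by rewrite !products0l addr0 productsNr xm_peifferr subrr.
by rewrite products0l.
Qed.

Lemma xm_ker_ts s x y : xm_t x = 0 -> xm_s y = 0 -> x *_[s] y = 0.
Proof.
move=> /xm_ker_t x0 /xm_ker_s y0; congr pair => /=; rewrite x0 y0.
  by rewrite !products0r addr0 productsNl xm_peifferl subrr.
by rewrite products0r.
Qed.

Definition cat1_of_xm : cat1_dialgebra k :=
  Cat1Dialgebra xm_s_id xm_t_id xm_ker_st xm_ker_ts.

End Cat1OfCrossedModule.

Section Cat1OfXmHom.
Variables (k : comPzRingType) (M N : crossed_module k) (f : xm_hom M N).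

Definition xm_map_fun (p : c1_E (cat1_of_xm M)) : c1_E (cat1_of_xm N) :=
  (xm_alpha f p.1, xm_beta f p.2).

Lemma xm_map_linear : linear xm_map_fun.
Proof. by move=> a p q; congr pair; rewrite /= dias_homP. Qed.

Lemma xm_mapM s p q : xm_map_fun (p *_[s] q) = xm_map_fun p *_[s] xm_map_fun q.
Proof.
congr pair; rewrite /= ?dias_funM //.
by rewrite !dias_homD dias_funM xm_hom_actl xm_hom_actr.
Qed.

Definition cat1_of_xm_hom : c1_hom (cat1_of_xm M) (cat1_of_xm N).
Proof.
refine (@C1Hom k _ _ (dias_hom_of xm_map_linear xm_mapM) _ _ _).
- by move=> p; rewrite !unfold_in => /eqP /= ->; rewrite dias_hom0.
- by move=> p; congr pair; rewrite /= dias_hom0.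
- by move=> p; congr pair; rewrite /= ?dias_hom0 // dias_homD xm_hom_mu.
Defined.

End Cat1OfXmHom.

Definition cat1_functor (k : comPzRingType) : functor (XDias k) (CDias k).
Proof.
refine (@Functor (XDias k) (CDias k) (@cat1_of_xm k) (@cat1_of_xm_hom k) _ _).
- by move=> M; apply: c1_hom_eq; apply: dias_hom_eq => -[].
- by move=> M N P g f; apply: c1_hom_eq; apply: dias_hom_eq.
Defined.

Lemma cat1_functor_faithful k : faithful (cat1_functor k).
Proof.
move=> M N f g /(congr1 (@c1_f _ _ _)) /= fg.
have {}fg (l : xm_L M) (x : xm_D M) :
    (xm_alpha f l, xm_beta f x) = (xm_alpha g l, xm_beta g x).
  pose ev (h : dias_hom (c1_E (cat1_of_xm M)) (c1_E (cat1_of_xm N))) :=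
    h (l, x).
  exact: (congr1 ev fg).
apply: xm_hom_eq; apply: dias_hom_eq => x.
- by have [] := fg x 0.
- by have [] := fg 0 x.
Qed.

Section XmHomOfCat1Hom.
Variables (k : comPzRingType) (M N : crossed_module k).
Variable g : c1_hom (cat1_of_xm M) (cat1_of_xm N).

Let inl_M := sdprod_inl (xm_act M).
Let inr_M := sdprod_inr (xm_act M).
Let inl_N := sdprod_inl (xm_act N).
Let inr_N := sdprod_inr (xm_act N).

Definition sdprod_alpha (l : xm_L M) : xm_L N := (g (inl_M l)).1.
Definition sdprod_beta (x : xm_D M) : xm_D N := (g (inr_M x)).2.

(** The factor L × 0 is Ker s, which [g] preserves because it commutes with [s]. *)
Lemma sdprod_alphaE l : g (inl_M l) = inl_N (sdprod_alpha l).
Proof.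
have s0 : val (c1_s (cat1_of_xm M) (inl_M l)) = 0 by [].
have := c1_f_s g (inl_M l); rewrite s0 dias_hom0 => /(congr1 snd) /= gl2.
by rewrite [LHS]surjective_pairing gl2.
Qed.

(** The factor 0 × D is the base, which [g] preserves as a morphism of cat^1-dialgebras. *)
Lemma sdprod_betaE x : g (inr_M x) = inr_N (sdprod_beta x).
Proof.
have /eqP gx1 := c1_f_sub g (sdprod_inr_sdbase x).
by rewrite [LHS]surjective_pairing gx1.
Qed.

Lemma sdprod_alpha_linear : linear sdprod_alpha.
Proof. by move=> a l l'; rewrite /sdprod_alpha !dias_homP. Qed.

Lemma sdprod_alphaM s l l' :
  sdprod_alpha (l *_[s] l') = sdprod_alpha l *_[s] sdprod_alpha l'.
Proof.
by rewrite {1}/sdprod_alpha !dias_funM !sdprod_alphaE -dias_funM.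
Qed.

Lemma sdprod_beta_linear : linear sdprod_beta.
Proof. by move=> a x x'; rewrite /sdprod_beta !dias_homP. Qed.

Lemma sdprod_betaM s x x' :
  sdprod_beta (x *_[s] x') = sdprod_beta x *_[s] sdprod_beta x'.
Proof. by rewrite {1}/sdprod_beta !dias_funM. Qed.

Definition xm_of_cat1_hom : xm_hom M N.
Proof.
refine (@XmHom k M N (dias_hom_of sdprod_alpha_linear sdprod_alphaM)
  (dias_hom_of sdprod_beta_linear sdprod_betaM) _ _ _).
(* Since t (l, 0) = (0, mu l), compatibility of [g] with t gives the commuting square in the second
   component. *)
- move=> l; have := c1_f_t g (inl_M l); rewrite sdprod_alphaE /= !addr0.
  by rewrite -/(inr_M (xm_mu M l)) sdprod_betaE => /(congr1 snd).
- move=> s x l /=; rewrite {1}/sdprod_alpha sdprod_actl dias_funM.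
  by rewrite sdprod_alphaE sdprod_betaE -sdprod_actl.
- move=> s l x /=; rewrite {1}/sdprod_alpha sdprod_actr dias_funM.
  by rewrite sdprod_alphaE sdprod_betaE -sdprod_actr.
Defined.

Lemma xm_of_cat1_homK : cat1_of_xm_hom xm_of_cat1_hom = g.
Proof.
apply: c1_hom_eq; apply: dias_hom_eq => p.
rewrite {2}(sdprod_split p) dias_homD sdprod_alphaE sdprod_betaE.
exact: (sdprod_split (xm_map_fun xm_of_cat1_hom p)).
Qed.

End XmHomOfCat1Hom.

Lemma cat1_functor_full k : full (cat1_functor k).
Proof. by move=> M N g; exists (xm_of_cat1_hom g); exact: xm_of_cat1_homK. Qed.

(** * From cat^1-dialgebras back to crossed modules *)

Section Cat1Theory.
Variables (k : comPzRingType) (A : cat1_dialgebra k).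
Let E := c1_E A.
Let s (e : E) : E := val (c1_s A e).
Let t (e : E) : E := val (c1_t A e).

Lemma c1_sK x : x \in subd_pred (c1_D A) -> s x = x.
Proof. by move=> xD; have /(congr1 val) := c1_s_id (SubdSort xD : c1_D A). Qed.

Lemma c1_ker_sB e : c1_s A (e - s e) = 0.
Proof. by rewrite dias_homB c1_s_id subrr. Qed.

Lemma c1_ker_tB e : c1_t A (e - t e) = 0.
Proof. by rewrite dias_homB c1_t_id subrr. Qed.

(** The difference [y - t y] lies in Ker t, which Ker s annihilates. With its mirror image, this
    gives both the Peiffer identities on Ker s and the multiplicativity of gamma. *)
Lemma c1_mul_stB st x y : c1_s A x = 0 -> x *_[st] t y = x *_[st] y.
Proof.
move=> x0; apply/esym/eqP; rewrite -subr_eq0 -productsBr; apply/eqP.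
exact: c1_ker_st x0 (c1_ker_tB y).
Qed.

Lemma c1_mul_tBs st x y : c1_s A y = 0 -> t x *_[st] y = x *_[st] y.
Proof.
move=> y0; apply/esym/eqP; rewrite -subr_eq0 -productsBl; apply/eqP.
exact: c1_ker_ts (c1_ker_tB x) y0.
Qed.

End Cat1Theory.

Lemma c1_hom_iso (k : comPzRingType) (A B : cat1_dialgebra k) (f : c1_hom A B)
    (g : c1_E B -> c1_E A) :
  cancel f g -> cancel g f -> is_iso (f : @hom (CDias k) A B).
Proof.
move=> fK gK.
have gs e : val (c1_s A (g e)) = g (val (c1_s B e)).
  by apply: (can_inj fK); rewrite -c1_f_s !gK.
have gt e : val (c1_t A (g e)) = g (val (c1_t B e)).
  by apply: (can_inj fK); rewrite -c1_f_t !gK.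
(* The base consists of the fixed points of s, so commuting with s is enough to preserve it. *)
have gD x : x \in subd_pred (c1_D B) -> g x \in subd_pred (c1_D A).
  by move=> /c1_sK xD; rewrite -xD -gs; exact: valP.
exists (@C1Hom k B A (dias_inv fK gK) gD gs gt).
by split; apply: c1_hom_eq; apply: dias_hom_eq.
Qed.

Section KernelSubdialgebra.
Variables (k : comPzRingType) (E F : dialgebra k) (f : dias_hom E F).

Definition ker_pred : {pred E} := fun e => f e == 0.

Lemma ker_submod : submod_closed ker_pred.
Proof.
split=> [|a x y]; rewrite !unfold_in ?dias_hom0 // dias_homP.
by move=> /eqP -> /eqP ->; rewrite scaler0 addr0.
Qed.

(** Kernels are two-sided ideals, which lets the base act on Ker s by multiplication in [E]. *)
Lemma ker_mull s x y : y \in ker_pred -> x *_[s] y \in ker_pred.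
Proof. by rewrite !unfold_in dias_funM => /eqP ->; rewrite products0r. Qed.

Lemma ker_mulr s x y : x \in ker_pred -> x *_[s] y \in ker_pred.
Proof. by rewrite !unfold_in dias_funM => /eqP ->; rewrite products0l. Qed.

Lemma ker_mul s : {in ker_pred &, forall x y, x *_[s] y \in ker_pred}.
Proof. by move=> x y _; exact: ker_mull. Qed.

Definition ker_subd : subdialgebra E := Subdialgebra ker_submod ker_mul.

Lemma ker_subdP (x : ker_subd) : f (val x) = 0.
Proof. exact/eqP/(valP x). Qed.

End KernelSubdialgebra.

Section CrossedModuleOfCat1.
Variables (k : comPzRingType) (A : cat1_dialgebra k).
Let E := c1_E A.
Let D := c1_D A.
Let K := ker_subd (c1_s A).

Definition ker_actl_fun s (x : D) (l : K) : K :=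
  @SubdSort k E K (val x *_[s] val l) (ker_mull s (val x) (valP l)).

Definition ker_actr_fun s (l : K) (x : D) : K :=
  @SubdSort k E K (val l *_[s] val x) (ker_mulr s (val x) (valP l)).

Definition ker_actl : products D K K.
Proof.
by refine (@Products k D K K ker_actl_fun _ _) => s x a y z;
  apply: val_inj; rewrite /= ?prod_linear_l ?prod_linear_r.
Defined.

Definition ker_actr : products K D K.
Proof.
by refine (@Products k K D K ker_actr_fun _ _) => s x a y z;
  apply: val_inj; rewrite /= ?prod_linear_l ?prod_linear_r.
Defined.

(** All thirty identities are the five laws of [E], evaluated on elements of the base and of Ker
    s. *)
Definition ker_action : dias_action D K.
Proof.
by refine (@DiasAction k D K ker_actl ker_actr _ _ _ _ _ _) => x y z;
  have [*] := dias_laws (val x) (val y) (val z); split; apply: val_inj.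
Defined.

Definition xm_of_cat1 : crossed_module k.
Proof.
refine (@CrossedModule k K D (dias_comp (c1_t A) (subd_incl K)) ker_action
  _ _ _ _).
- by move=> s x l /=; rewrite dias_funM c1_t_id.
- by move=> s l x /=; rewrite dias_funM c1_t_id.
- move=> s l l'; apply: val_inj => /=.
  by apply: c1_mul_tBs; exact: ker_subdP.
- move=> s l l'; apply: val_inj => /=.
  by apply: c1_mul_stB; exact: ker_subdP.
Defined.

Let E' := c1_E (cat1_of_xm xm_of_cat1).

Definition cat1_counit_fun (p : E') : E := val p.1 + val p.2.

Lemma cat1_counit_linear : linear cat1_counit_fun.
Proof.
move=> a p q; rewrite /cat1_counit_fun scalerDr.
rewrite -[LHS]/(a *: val p.1 + val q.1 + (a *: val p.2 + val q.2)).
by rewrite (AC (2*2) ((1*3)*(2*4))).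
Qed.

(** The first component of a semidirect product collects the three products with a factor in Ker s,
    so both sides are the same four terms. *)
Lemma cat1_counitM s p q :
  cat1_counit_fun (p *_[s] q) = cat1_counit_fun p *_[s] cat1_counit_fun q.
Proof.
rewrite /cat1_counit_fun /= !(productsDl, productsDr).
by rewrite (AC (3*1) ((1*3)*(2*4))).
Qed.

Definition cat1_counit : c1_hom (cat1_of_xm xm_of_cat1) A.
Proof.
refine (@C1Hom k _ _ (dias_hom_of cat1_counit_linear cat1_counitM) _ _ _).
- move=> p; rewrite unfold_in /= /cat1_counit_fun => /eqP ->.
  by rewrite add0r; exact: valP.
- by move=> p; rewrite /= /cat1_counit_fun dias_homD ker_subdP c1_s_id /=.
- move=> p; rewrite /= /cat1_counit_fun dias_homD c1_t_id /=.
  by rewrite add0r.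
Defined.

Lemma cat1_counit_inv_subproof e : e - val (c1_s A e) \in subd_pred K.
Proof. by rewrite unfold_in c1_ker_sB. Qed.

Definition cat1_counit_inv (e : E) : E' :=
  (@SubdSort k E K _ (cat1_counit_inv_subproof e), c1_s A e).

Lemma cat1_counit_iso : is_iso (cat1_counit : @hom (CDias k) _ _).
Proof.
apply: (c1_hom_iso (g := cat1_counit_inv)) => [[l x]|e] /=; last first.
  by rewrite /cat1_counit_fun /= subrK.
have slx : c1_s A (val l + val x) = x.
  by rewrite dias_homD ker_subdP add0r c1_s_id.
by congr pair => //; apply: val_inj; rewrite /= slx addrK.
Qed.

End CrossedModuleOfCat1.

Lemma cat1_functor_weak_equivalence k : weak_equivalence (cat1_functor k).
Proof.
split; [exact: cat1_functor_full | exact: cat1_functor_faithful |].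
by move=> A; exists (xm_of_cat1 A), (cat1_counit A); exact: cat1_counit_iso.
Qed.

(** * From cat^1-dialgebras to internal categories *)

Lemma composable_pair_eq (k : comPzRingType) (E D : dialgebra k)
    (s t : dias_hom E D) e1 e1' e2 e2' (h : t e1 = s e1') (h' : t e2 = s e2') :
  e1 = e2 -> e1' = e2' -> composable_pair h = composable_pair h'.
Proof. by move=> e12 e12'; apply: val_inj; rewrite /= e12 e12'. Qed.

Section InternalCategoryOfCat1.
Variables (k : comPzRingType) (A : cat1_dialgebra k).
Let E := c1_E A.
Let D := c1_D A.
Let s := c1_s A.
Let t := c1_t A.

Definition c1_gamma_fun (p : composable s t) : E :=
  (val p).1 + (val p).2 - val (t (val p).1).

Lemma c1_gamma_linear : linear c1_gamma_fun.
Proof.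
move=> a p q; rewrite /c1_gamma_fun /= dias_homP subd_valP !scalerDr scalerN.
by rewrite opprD (AC (2*2*2) ((1*3*5)*(2*4*6))).
Qed.

Lemma composableP (p : composable s t) : t (val p).1 = s (val p).2.
Proof. exact/eqP/(valP p). Qed.

(* With p = (e, e') and q = (f, f'), the elements e' - t e and f' - t f lie in
   Ker s, so multiplying them by f, e or by t f, t e is the same. *)
Lemma c1_gammaM st p q :
  c1_gamma_fun (p *_[st] q) = c1_gamma_fun p *_[st] c1_gamma_fun q.
Proof.
have := composableP p; have := composableP q; rewrite /c1_gamma_fun /=.
move: (val p) (val q) => [e e'] [f f'] /= tf te.
have expand u v : s u = 0 -> s v = 0 -> (e + u) *_[st] (f + v) =
    e *_[st] f + val (t e) *_[st] v + (u *_[st] val (t f) + u *_[st] v).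
  by move=> u0 v0; rewrite (c1_mul_stB _ _ u0) (c1_mul_tBs _ _ v0)
    productsDl !productsDr.
rewrite -!addrA expand ?te ?tf ?c1_ker_sB // -te -tf.
rewrite dias_funM /= !productsBl !productsBr.
set c := val (t e) *_[st] val (t f); set d := e' *_[st] val (t f).
set x := val (t e) *_[st] f' - c.
by rewrite (AC (2*(2*3)) ((1*5*4)*(2*7)*(3*6))) /= !subrr !addr0 addrA.
Qed.

Definition c1_gamma : dias_hom (composable s t) E :=
  dias_hom_of c1_gamma_linear c1_gammaM.

Lemma c1_gamma_s e e' (h : t e = s e') : s (c1_gamma (composable_pair h)) = s e.
Proof.
by rewrite /= /c1_gamma_fun dias_homB dias_homD c1_s_id /= -h addrK.
Qed.

Lemma c1_gamma_t e e' (h : t e = s e') :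
  t (c1_gamma (composable_pair h)) = t e'.
Proof.
by rewrite /= /c1_gamma_fun dias_homB dias_homD c1_t_id /= addrAC subrr add0r.
Qed.

Definition ic_of_cat1 : internal_category k.
Proof.
refine (@InternalCategory k E D s t (subd_incl D) c1_gamma
  (c1_s_id (c:=A)) (c1_t_id (c:=A)) c1_gamma_s c1_gamma_t _ _ _).
- by move=> e; rewrite /= /c1_gamma_fun /= c1_t_id addrAC subrr add0r.
- by move=> e; rewrite /= /c1_gamma_fun /= addrK.
- move=> e1 e2 e3 h12 h23.
  (* As the composite of [e1] and [e2] has target [t e2], both bracketings equal e1 + e2 + e3 - t e1
     - t e2. *)
  rewrite -[LHS]/(c1_gamma (composable_pair h12) + e3 -
    val (t (c1_gamma (composable_pair h12)))) c1_gamma_t.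
  rewrite -[RHS]/(e1 + (e2 + e3 - val (t e2)) - val (t e1)).
  rewrite -[LHS]/(e1 + e2 - val (t e1) + e3 - val (t e2)).
  by rewrite (AC (3*1*1) (1*((2*4)*5)*3)).
Defined.

End InternalCategoryOfCat1.

Section IcHomOfC1Hom.
Variables (k : comPzRingType) (A B : cat1_dialgebra k) (f : c1_hom A B).

Lemma c1_hom_subP (d : c1_D A) :
  dias_comp f (subd_incl (c1_D A)) d \in subd_pred (c1_D B).
Proof. exact/c1_f_sub/valP. Qed.

Let restriction : dias_hom (c1_D A) (c1_D B) := dias_corestrict c1_hom_subP.

Lemma restriction_s e : restriction (c1_s A e) = c1_s B (f e).
Proof. by apply: val_inj; rewrite /= c1_f_s. Qed.

Lemma restriction_t e : restriction (c1_t A e) = c1_t B (f e).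
Proof. by apply: val_inj; rewrite /= c1_f_t. Qed.

Definition ic_of_c1_hom : ic_hom (ic_of_cat1 A) (ic_of_cat1 B).
Proof.
refine (@IcHom k (ic_of_cat1 A) (ic_of_cat1 B) (c1_f f) restriction
  restriction_s restriction_t (fun _ => erefl) _).
(* Composition is a linear expression in [e], [e'] and t e, and [f] commutes with t. *)
move=> e e' h; rewrite -[RHS]/(f e + f e' - val (c1_t B (f e))) c1_f_t.
by rewrite -dias_homD -dias_homB.
Defined.

End IcHomOfC1Hom.

Definition ic_functor (k : comPzRingType) : functor (CDias k) (IDias k).
Proof.
refine (@Functor (CDias k) (IDias k) (@ic_of_cat1 k) (@ic_of_c1_hom k) _ _).
- by move=> A; apply: ic_hom_eq; apply: dias_hom_eq => // x; apply: subd_inj.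
- by move=> A B C g f; apply: ic_hom_eq; apply: dias_hom_eq => // x;
    apply: subd_inj.
Defined.

Lemma ic_functor_faithful k : faithful (ic_functor k).
Proof. by move=> A B f g /(congr1 (@ic_phi _ _ _)) /c1_hom_eq. Qed.

(** In [ic_of_cat1] the map sigma is the inclusion of the base. Compatibility with sigma therefore
    says that the object map is the restriction of the arrow map, and the arrow map alone is the
    preimage. *)
Lemma ic_functor_full k : full (ic_functor k).
Proof.
move=> A B g; pose phi : dias_hom (c1_E A) (c1_E B) := ic_phi g.
pose psi : dias_hom (c1_D A) (c1_D B) := ic_psi g.
have phi_val (d : c1_D A) : phi (val d) = val (psi d) := ic_hom_sigma g d.
have phi_sub x : x \in subd_pred (c1_D A) -> phi x \in subd_pred (c1_D B).
  by move=> /c1_sK <-; rewrite phi_val; exact: valP.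
have phi_s e : val (c1_s B (phi e)) = phi (val (c1_s A e)).
  by rewrite phi_val; congr val; rewrite [RHS](ic_hom_s g).
have phi_t e : val (c1_t B (phi e)) = phi (val (c1_t A e)).
  by rewrite phi_val; congr val; rewrite [RHS](ic_hom_t g).
exists (C1Hom phi_sub phi_s phi_t).
apply: ic_hom_eq; apply: dias_hom_eq => // d.
by apply: (@subd_inj _ _ (c1_D B)); rewrite /= -phi_val.
Qed.

Lemma ic_hom_iso (k : comPzRingType) (A B : internal_category k)
    (f : ic_hom A B) (g : ic_E B -> ic_E A) (h : ic_D B -> ic_D A) :
  cancel (ic_phi f) g -> cancel g (ic_phi f) ->
  cancel (ic_psi f) h -> cancel h (ic_psi f) ->
  is_iso (f : @hom (IDias k) A B).
Proof.
move=> phiK gK psiK hK.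
pose phi' := dias_inv phiK gK; pose psi' := dias_inv psiK hK.
have hs e : psi' (ic_s B e) = ic_s A (phi' e).
  by apply: (can_inj psiK); rewrite ic_hom_s /= hK gK.
have ht e : psi' (ic_t B e) = ic_t A (phi' e).
  by apply: (can_inj psiK); rewrite ic_hom_t /= hK gK.
have hsigma d : phi' (ic_sigma B d) = ic_sigma A (psi' d).
  by apply: (can_inj phiK); rewrite ic_hom_sigma /= hK gK.
have hgamma e e' (c : ic_t B e = ic_s B e') :
    phi' (ic_gamma B (composable_pair c)) =
    ic_gamma A (composable_pair (composable_map hs ht c)).
  apply: (can_inj phiK); rewrite ic_hom_gamma /= gK; congr (ic_gamma B _).
  by apply: composable_pair_eq; rewrite /= gK.
exists (IcHom hsigma hgamma).
by split; apply: ic_hom_eq; apply: dias_hom_eq.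
Qed.

(** * From internal categories back to cat^1-dialgebras *)

Section Cat1OfInternalCategory.
Variables (k : comPzRingType) (I : internal_category k).
Let E := ic_E I.
Let D := ic_D I.
Let s := ic_s I.
Let t := ic_t I.
Let sigma := ic_sigma I.
Let gamma := ic_gamma I.

(* Since s sigma = id, this is the image of sigma. *)
Definition identities_pred : {pred E} := fun e => sigma (s e) == e.

Lemma identities_submod : submod_closed identities_pred.
Proof.
split=> [|a x y]; rewrite !unfold_in ?dias_hom0 // !dias_homP.
by move=> /eqP -> /eqP ->.
Qed.

Lemma identities_mul st :
  {in identities_pred &, forall x y, x *_[st] y \in identities_pred}.
Proof. by move=> x y; rewrite !unfold_in !dias_funM => /eqP -> /eqP ->. Qed.

Definition identities : subdialgebra E :=
  Subdialgebra identities_submod identities_mul.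

Lemma sigma_identities (f : dias_hom E D) e :
  dias_comp sigma f e \in subd_pred identities.
Proof. by rewrite unfold_in /= /s ic_s_sigma. Qed.

Definition cat1_s : dias_hom E identities :=
  dias_corestrict (sigma_identities s).
Definition cat1_t : dias_hom E identities :=
  dias_corestrict (sigma_identities t).

Lemma identitiesP (d : identities) : sigma (s (val d)) = val d.
Proof. exact/eqP/(valP d). Qed.

Lemma cat1_s_id (d : identities) : cat1_s (val d) = d.
Proof. by apply: val_inj; rewrite /= identitiesP. Qed.

Lemma cat1_t_id (d : identities) : cat1_t (val d) = d.
Proof. by apply: val_inj; rewrite /= -identitiesP /t ic_t_sigma. Qed.

Lemma cat1_ker_s x : cat1_s x = 0 -> s x = 0.
Proof.
by move=> /(congr1 val) /= /(congr1 s); rewrite /s ic_s_sigma dias_hom0.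
Qed.

Lemma cat1_ker_t x : cat1_t x = 0 -> t x = 0.
Proof.
by move=> /(congr1 val) /= /(congr1 t); rewrite /t ic_t_sigma dias_hom0.
Qed.

(** The unit law for an arbitrary composability proof and an arrow only known to equal an
    identity. *)
Lemma gamma_unitl e e' (h : t e = s e') :
  e = sigma (s e') -> gamma (composable_pair h) = e'.
Proof.
move=> ee'; rewrite -[RHS](ic_unitl e'); congr (gamma _).
exact: composable_pair_eq.
Qed.

Lemma gamma_unitr e e' (h : t e = s e') :
  e' = sigma (t e) -> gamma (composable_pair h) = e.
Proof.
move=> ee'; rewrite -[RHS](ic_unitr e); congr (gamma _).
exact: composable_pair_eq.
Qed.

(** By linearity of [sigma], the zero arrow is the identity of the object 0. *)
Lemma gamma0l x (h : t 0 = s x) : s x = 0 -> gamma (composable_pair h) = x.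
Proof. by move=> x0; apply: gamma_unitl; rewrite x0 dias_hom0. Qed.

Lemma gamma0r x (h : t x = s 0) : t x = 0 -> gamma (composable_pair h) = x.
Proof. by move=> x0; apply: gamma_unitr; rewrite x0 dias_hom0. Qed.

(** The pair (e, e') is the sum of the composable pairs (e, sigma (t e)) and (0, e' - sigma (t e)).
    Additivity of [gamma] separates them, and the unit laws evaluate each. *)
Lemma ic_gammaE e e' (h : t e = s e') :
  gamma (composable_pair h) = e + e' - sigma (t e).
Proof.
have h1 : t e = s (sigma (t e)) by rewrite /s ic_s_sigma.
have s0 : s (e' - sigma (t e)) = 0 by rewrite dias_homB -h1 h subrr.
have h2 : t 0 = s (e' - sigma (t e)) by rewrite s0 dias_hom0.
transitivity (gamma (composable_pair h1) + gamma (composable_pair h2)).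
  rewrite -dias_homD; congr (gamma _); apply: val_inj; congr pair => /=.
    by rewrite addr0.
  by rewrite addrC subrK.
by rewrite gamma_unitr // gamma0l // addrA.
Qed.

(* The two factors are gamma (x, 0) and gamma (0, y), and gamma is
   multiplicative. *)
Lemma cat1_ker_ts st x y : cat1_t x = 0 -> cat1_s y = 0 -> x *_[st] y = 0.
Proof.
move=> /cat1_ker_t x0 /cat1_ker_s y0.
have hx : t x = s 0 by rewrite x0 dias_hom0.
have hy : t 0 = s y by rewrite y0 dias_hom0.
rewrite -(gamma0r hx) // -(gamma0l hy) // -dias_funM.
rewrite -[RHS](dias_hom0 gamma); congr (gamma _); apply: val_inj.
by congr pair; rewrite /= (products0l, products0r).
Qed.

(** Here [x] is the composite of (0, x) and [y] that of (y, 0); the componentwise product of these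
    pairs is zero. *)
Lemma cat1_ker_st st x y : cat1_s x = 0 -> cat1_t y = 0 -> x *_[st] y = 0.
Proof.
move=> /cat1_ker_s x0 /cat1_ker_t y0.
have hx : t 0 = s x by rewrite x0 dias_hom0.
have hy : t y = s 0 by rewrite y0 dias_hom0.
rewrite -(gamma0l hx) // -(gamma0r hy) // -dias_funM.
rewrite -[RHS](dias_hom0 gamma); congr (gamma _); apply: val_inj.
by congr pair; rewrite /= (products0l, products0r).
Qed.

Definition cat1_of_ic : cat1_dialgebra k :=
  Cat1Dialgebra cat1_s_id cat1_t_id cat1_ker_st cat1_ker_ts.

(** Identifies identity arrows with objects; [sigma] is the inverse. *)
Let source : dias_hom identities D := dias_comp s (subd_incl identities).

Lemma source_cat1_s e : source (cat1_s e) = s e.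
Proof. exact: ic_s_sigma. Qed.

Lemma source_cat1_t e : source (cat1_t e) = t e.
Proof. exact: ic_s_sigma. Qed.

Definition ic_counit : ic_hom (ic_of_cat1 cat1_of_ic) I.
Proof.
refine (@IcHom k (ic_of_cat1 cat1_of_ic) I (dias_id E) source
  source_cat1_s source_cat1_t _ _).
- by move=> d; rewrite /= identitiesP.
(* The composition rebuilt from s and t is the formula already forced on [gamma]. *)
- by move=> e e' h; rewrite ic_gammaE.
Defined.

Lemma sigma_identity d : sigma d \in subd_pred identities.
Proof. by rewrite unfold_in /s ic_s_sigma. Qed.

Lemma ic_counit_iso : is_iso (ic_counit : @hom (IDias k) _ _).
Proof.
apply: (@ic_hom_iso k _ _ ic_counit id (dias_corestrict sigma_identity))
  => // d.
- by apply: val_inj; rewrite /= identitiesP.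
- by rewrite /= /s ic_s_sigma.
Qed.

End Cat1OfInternalCategory.

Lemma ic_functor_weak_equivalence k : weak_equivalence (ic_functor k).
Proof.
split; [exact: ic_functor_full | exact: ic_functor_faithful |].
by move=> I; exists (cat1_of_ic I), (ic_counit I); exact: ic_counit_iso.
Qed.

Theorem theorem4p4 (k : comPzRingType) :
  equivalent_categories (XDias k) (CDias k) /\
  equivalent_categories (CDias k) (IDias k) /\
  equivalent_categories (XDias k) (IDias k).
Proof.
have XC := cat1_functor_weak_equivalence k.
have CI := ic_functor_weak_equivalence k.
split; first exact: weak_equivalence_equivalent XC.
split; first exact: weak_equivalence_equivalent CI.
exact: weak_equivalence_equivalent (weak_equivalence_comp CI XC).
Qed.
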